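(* Let $\mathsf{K}$ be a quasivariety with a near unanimity term of arity $n\geq 3$. Then $\mathsf{K}$ has the weak ES property if and only if no finitely generated subdirect product $\mathbf{A}\leq\mathbf{A}_1\times\dots\times\mathbf{A}_{n-1}$ with $\mathbf{A}_1,\dots,\mathbf{A}_{n-1}\in\mathsf{K}_{\mathrm{RFSI}}$ (and $\mathbf{A}\in\mathsf{K}$) has a subalgebra that is fully epic in $\mathsf{K}$.
   Context: A quasivariety is a class of similar algebras closed under isomorphic copies, subalgebras, direct products and ultraproducts. A term $\varphi$ of arity $n\geq3$ is a near unanimity term for $\mathsf{K}$ if $\mathsf{K}\models x\approx\varphi(y,x,\dots,x)\approx\varphi(x,y,x,\dots,x)\approx\dots\approx\varphi(x,\dots,x,y)$. $\mathsf{K}$ has the weak ES property if every $\mathsf{K}$-epimorphism (right-cancellable homomorphism w.r.t. homomorphisms into members of $\mathsf{K}$) between finitely generated members of $\mathsf{K}$ is surjective. $\mathsf{K}_{\mathrm{RFSI}}$ is the class of nontrivial $\mathbf{C}\in\mathsf{K}$ that are finitely subdirectly irreducible relative to $\mathsf{K}$: for every subdirect embedding $f\colon\mathbf{C}\to\mathbf{B}_1\times\dots\times\mathbf{B}_m$ with finitely many $\mathbf{B}_i\in\mathsf{K}$, some $p_i\circ f$ is an isomorphism. $\mathrm{Con}_{\mathsf{K}}(\mathbf{B})$ is the set of congruences $\theta$ with $\mathbf{B}/\theta\in\mathsf{K}$. $\mathbf{A}\leq\mathbf{B}$ is epic in $\mathsf{K}$ if the inclusion is a $\mathsf{K}$-epimorphism;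 it is full in $\mathsf{K}$ if it is proper, almost total ($B=\mathrm{Sg}^{\mathbf{B}}(A\cup\{b\})$ for some $b$), and every $\theta\in\mathrm{Con}_{\mathsf{K}}(\mathbf{B})\setminus\{\mathrm{id}_B\}$ relates each $b\in B$ to some $a\in A$; fully epic means full and epic. *)

(* Defs.v *)
From mathcomp Require Import all_boot.
From Stdlib Require Import ClassicalEpsilon.

Set Implicit Arguments.
Unset Strict Implicit.
Unset Printing Implicit Defensive.

(* Basic universal algebra over a signature (F, ar): operation symbols F   *)
(* with finite arities ar f.  Algebras have NONEMPTY carriers (the usual   *)
(* convention in universal algebra).                                       *)
Section UA.
Variables (F : Type) (ar : F -> nat).

Record algebra := Algebra {
  carrier :> Type;
  ops : forall f : F, ('I_(ar f) -> carrier) -> carrier;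
  alg_inh : inhabited carrier
}.
Arguments ops a f _ : clear implicits.
Arguments alg_inh a : clear implicits.

Definition is_hom (A B : algebra) (h : A -> B) : Prop :=
  forall (f : F) (args : 'I_(ar f) -> A),
    h (ops A f args) = ops B f (fun i => h (args i)).

Definition surj (A B : Type) (h : A -> B) : Prop := forall b, exists a, h a = b.

Definition is_iso (A B : algebra) (h : A -> B) : Prop :=
  is_hom h /\ injective h /\ surj h.

Definition subuniverse (B : algebra) (S : B -> Prop) : Prop :=
  forall (f : F) (args : 'I_(ar f) -> B),
    (forall i, S (args i)) -> S (ops B f args).

Definition subalg (B : algebra) (S : B -> Prop) (cl : subuniverse S)
  (ne : inhabited {x : B | S x}) : algebra :=
  @Algebra {x : B | S x}
    (fun f args => exist _ (ops B f (fun i => proj1_sig (args i)))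
                            (cl f _ (fun i => proj2_sig (args i))))
    ne.

Definition sg (B : algebra) (X : B -> Prop) (b : B) : Prop :=
  forall S : B -> Prop, subuniverse S -> (forall x, X x -> S x) -> S b.

Definition fingen (B : algebra) : Prop :=
  exists (k : nat) (g : 'I_k -> B), forall b, sg (fun x => exists i, g i = x) b.

Lemma prod_inh (I : Type) (A : I -> algebra) : inhabited (forall i, A i).
Proof. constructor; intro i; exact (epsilon (alg_inh (A i)) (fun _ => True)). Qed.

Definition prod_alg (I : Type) (A : I -> algebra) : algebra :=
  @Algebra (forall i, A i)
    (fun f args => fun i => ops (A i) f (fun j => args j i))
    (prod_inh A).

Definition ultrafilter (I : Type) (U : (I -> Prop) -> Prop) : Prop :=
  [/\ ~ U (fun _ => False),
      U (fun _ => True),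
      (forall X Y : I -> Prop, U X -> (forall i, X i -> Y i) -> U Y),
      (forall X Y : I -> Prop, U X -> U Y -> U (fun i => X i /\ Y i)) &
      (forall X : I -> Prop, U X \/ U (fun i => ~ X i))].

Inductive term (V : Type) : Type :=
  | Var : V -> term V
  | App : forall f : F, ('I_(ar f) -> term V) -> term V.

Fixpoint eval (V : Type) (A : algebra) (v : V -> A) (t : term V) : A :=
  match t with
  | Var x => v x
  | App f ts => ops A f (fun i => eval v (ts i))
  end.

Variable K : algebra -> Prop.

(* K is a quasivariety: closed under isomorphic copies (I), subalgebras (S),
   arbitrary direct products (P, including the empty product) and
   ultraproducts (P_U).  Since quotient types are not primitive, "B is an
   ultraproduct prod A / U" is expressed, up to isomorphism, by a surjective
   homomorphism from prod A onto B whose kernel is the ultrafilter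
   congruence. *)
Definition quasivariety : Prop :=
  [/\ (forall A B : algebra, K A -> forall h : A -> B, is_iso h -> K B),
      (forall (B : algebra) (S : B -> Prop) (cl : subuniverse S)
              (ne : inhabited {x : B | S x}), K B -> K (subalg cl ne)),
      (forall (I : Type) (A : I -> algebra), (forall i, K (A i)) -> K (prod_alg A)) &
      (forall (I : Type) (A : I -> algebra) (U : (I -> Prop) -> Prop),
         (forall i, K (A i)) -> ultrafilter U ->
         forall (B : algebra) (h : prod_alg A -> B), is_hom h -> surj h ->
         (forall x y : prod_alg A, h x = h y <-> U (fun i => x i = y i)) ->
         K B)].

Definition nu_term (n : nat) (phi : term 'I_n) : Prop :=
  forall A : algebra, K A -> forall (x y : A) (i : 'I_n),
    @eval _ A (fun j => if j == i then y else x) phi = x.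

Definition K_epi (A B : algebra) (h : A -> B) : Prop :=
  is_hom h /\
  forall C : algebra, K C -> forall g1 g2 : B -> C, is_hom g1 -> is_hom g2 ->
    (forall a, g1 (h a) = g2 (h a)) -> forall b, g1 b = g2 b.

Definition weak_ES : Prop :=
  forall A B : algebra, K A -> K B -> fingen A -> fingen B ->
    forall h : A -> B, K_epi h -> surj h.

Definition RFSI (C : algebra) : Prop :=
  [/\ K C,
      (exists x y : C, x <> y) &
      forall (m : nat) (B : 'I_m -> algebra), (forall i, K (B i)) ->
        forall f : C -> prod_alg B, is_hom f -> injective f ->
        (forall i (b : B i), exists c, f c i = b) ->
        exists i, is_iso (fun c => f c i)].

(* congruences and Con_K(B); "B/theta in K" is expressed (up to iso) by the
   existence of a surjective homomorphism onto a member of K with kernel theta *)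
Definition congruence (B : algebra) (theta : B -> B -> Prop) : Prop :=
  [/\ (forall x, theta x x), (forall x y, theta x y -> theta y x),
      (forall x y z, theta x y -> theta y z -> theta x z) &
      forall f (a b : 'I_(ar f) -> B), (forall i, theta (a i) (b i)) ->
        theta (ops B f a) (ops B f b)].

Definition ConK (B : algebra) (theta : B -> B -> Prop) : Prop :=
  congruence theta /\
  exists (C : algebra) (h : B -> C),
    [/\ K C, is_hom h, surj h & forall x y, h x = h y <-> theta x y].

Definition is_id (B : Type) (theta : B -> B -> Prop) : Prop :=
  forall x y, theta x y <-> x = y.

Definition full (B : algebra) (S : B -> Prop) : Prop :=
  [/\ (exists b, ~ S b),
      (exists b, forall x, sg (fun y => S y \/ y = b) x) &
      forall theta, ConK theta -> ~ is_id theta ->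
        forall b : B, exists a, S a /\ theta b a].

Definition fully_epic (B : algebra) (S : B -> Prop) : Prop :=
  exists (cl : subuniverse S) (ne : inhabited {x : B | S x}),
    full S /\ K_epi (fun x : subalg cl ne => proj1_sig x).

End UA.

(* Main.v *)
(** A fully epic subalgebra [T] of a finitely generated [D] refutes the weak ES
    property because dominions are compact: closure under ultraproducts yields
    a finitely generated subalgebra of [T] that is still epic in [D].

    Conversely, a non-surjective epimorphism into a finitely generated [B]
    yields a proper, almost total, epic subalgebra [A] of [B] together with
    [b] outside [A] such that [A] and [b] generate [B].  Zorn's lemma provides a
    relative congruence [theta] of [B] maximal among those not relating [b] to
    [A]; modulo [theta] the subalgebra is fully epic.  By maximality, the near
    unanimity term bounds by [n - 1] the length of the irredundant
    representations of [theta] as a meet of relative congruences.  In one of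
    greatest length whose components cannot be enlarged, every component is
    meet irreducible, so [B / theta] is a subdirect product of at most [n - 1]
    relatively finitely subdirectly irreducible algebras; repeating a factor
    makes the number exactly [n - 1]. *)

From mathcomp Require Import all_boot.
From mathcomp Require Import boolp classical_sets filter.
Require Import Defs.
From Stdlib Require Import ClassicalEpsilon.

Set Implicit Arguments.
Unset Strict Implicit.
Unset Printing Implicit Defensive.

(** * Subuniverses, homomorphisms and quotients *)

Section Algebras.
Variables (F : Type) (ar : F -> nat).
Implicit Types A B C D : algebra ar.

Lemma sg_subuniverse B (X : B -> Prop) : subuniverse (sg X).
Proof.
by move=> f args h S clS XS; apply: (clS) => i; exact: h.
Qed.

Lemma sg_gen B (X : B -> Prop) x : X x -> sg X x.
Proof. by move=> Xx S _; exact. Qed.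

Lemma sg_le B (X Y : B -> Prop) : (forall x, X x -> sg Y x) ->
  forall x, sg X x -> sg Y x.
Proof. by move=> XY x; apply; [exact: sg_subuniverse|]. Qed.

Lemma is_hom_comp A B C (h : A -> B) (g : B -> C) :
  is_hom h -> is_hom g -> is_hom (fun x => g (h x)).
Proof. by move=> hh hg f args; rewrite hh hg. Qed.

Lemma is_hom_prod (I : Type) B (C : I -> algebra ar) (h : forall i, B -> C i) :
  (forall i, is_hom (h i)) -> is_hom (B := prod_alg C) (fun b i => h i b).
Proof. by move=> hh f args; apply: functional_extensionality_dep => i; exact: hh. Qed.

Lemma image_subuniverse A B (h : A -> B) (S : A -> Prop) : is_hom h ->
  subuniverse S -> subuniverse (fun b => exists a, S a /\ h a = b).
Proof.
move=> hh clS f args /choice[g gP]; exists (ops g); split.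
  by apply: clS => i; have [] := gP i.
by rewrite hh; congr ops; apply: funext => i; have [] := gP i.
Qed.

Lemma preimage_subuniverse A B (h : A -> B) (S : B -> Prop) : is_hom h ->
  subuniverse S -> subuniverse (fun a => S (h a)).
Proof. by move=> hh clS f args hS; rewrite hh; exact: clS. Qed.

Lemma sg_image A B (h : A -> B) (X : A -> Prop) (Y : B -> Prop) x :
  is_hom h -> (forall x, X x -> Y (h x)) -> sg X x -> sg Y (h x).
Proof.
move=> hh XY /(_ (fun a => sg Y (h a))); apply.
  by apply: preimage_subuniverse => //; exact: sg_subuniverse.
by move=> y /XY; exact: sg_gen.
Qed.

Lemma equalizer_subuniverse A B (g1 g2 : A -> B) : is_hom g1 -> is_hom g2 ->
  subuniverse (fun a => g1 a = g2 a).
Proof. by move=> h1 h2 f args e; rewrite h1 h2; congr ops; apply: funext. Qed.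

Lemma eval_hom V A B (h : A -> B) (v : V -> A) (t : term ar V) : is_hom h ->
  h (eval v t) = eval (fun x => h (v x)) t.
Proof.
by move=> hh; elim: t => [//|f ts IH] /=; rewrite hh; congr ops; apply: funext.
Qed.

Lemma eval_subuniverse V B (S : B -> Prop) (v : V -> B) (t : term ar V) :
  subuniverse S -> (forall x, S (v x)) -> S (eval v t).
Proof. by move=> clS vS; elim: t => [//|f ts IH] /=; exact: clS. Qed.

(* The quotient is realised on a system of representatives. *)
Lemma quotient_exists B (theta : B -> B -> Prop) : congruence theta ->
  exists C (q : B -> C), [/\ is_hom q, surj q & forall x y, q x = q y <-> theta x y].
Proof.
case=> rfl sym trans comp.
(* The choice depends only on the predicate [theta x], so related elements receive the same
   representative. *)
pose r x := epsilon (alg_inh B) (theta x).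
have rP x : theta x (r x) by apply: (epsilon_spec (alg_inh B)); exists x.
have rE x y : theta x y -> r x = r y.
  move=> xy; rewrite /r; suff -> : theta x = theta y by [].
  apply: funext => z; apply: propext; split; apply: trans => //; exact: sym.
have rr x : r (r x) = r x by apply: rE; exact: sym.
pose q x : {x | r x = x} := exist _ (r x) (rr x).
have qE x y : r x = r y -> q x = q y by move=> ?; exact: eq_exist.
have inh : inhabited {x | r x = x} by case: (alg_inh B) => x; exact: (inhabits (q x)).
pose C := @Algebra F ar {x | r x = x}
  (fun f args => q (ops (fun i => proj1_sig (args i)))) inh.
exists C, q; split.
- by move=> f args; apply: qE; apply: rE; apply: comp => i /=; exact: rP.
- by move=> [x rx]; exists x; exact: eq_exist.
- move=> x y; split=> [[e]|/rE/qE//].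
  by apply: trans (rP x) _; rewrite e; exact: sym.
Qed.

End Algebras.

(** * Ultraproducts over directed sets *)

Lemma ultrafilter_forall (I : Type) (U : (I -> Prop) -> Prop) k
    (X : 'I_k -> I -> Prop) :
  ultrafilter U -> (forall j, U (X j)) -> U (fun i => forall j, X j i).
Proof.
case=> _ UT US UI _; elim: k X => [|k IH] X UX; first by apply: US UT _ => i _ [].
apply: US (UI _ _ (UX ord0) (IH (fun j => X (lift ord0 j)) (fun j => UX _))) _.
by move=> i [X0 XS] j; case: (unliftP ord0 j) => [j' ->|->].
Qed.

(** By directedness the cones [le i] generate a proper filter; any ultrafilter extending it
    serves. *)
Lemma directed_ultrafilter (I : Type) (le : I -> I -> Prop) :
  inhabited I -> (forall i, le i i) ->
  (forall i j k, le i j -> le j k -> le i k) ->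
  (forall i j, exists k, le i k /\ le j k) ->
  exists U, ultrafilter U /\ forall i, U (le i).
Proof.
move=> [i0] rfl trans dir.
pose Fl : set_system I := fun X => exists i, forall j, le i j -> X j.
have FF : ProperFilter Fl.
  split; first by case=> i /(_ i (rfl i)).
  split; first by exists i0.
  - move=> X Y [i iX] [j jY]; have [k [ik jk]] := dir i j.
    by exists k => l kl; split; [apply: iX|apply: jY]; exact: trans kl.
  - by move=> X Y XY [i iX]; exists i => j /iX /XY.
have [U [UU FU]] := ultraFilterLemma FF.
exists U; split; last by move=> i; apply: FU; exists i.
split.
- exact: filter_not_empty.
- exact: filterT.
- by move=> X Y UX XY; exact: filterS UX.
- by move=> X Y; exact: filterI.
- by move=> X; exact: in_ultra_setVsetC.
Qed.

Section Quasivariety.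
Variables (F : Type) (ar : F -> nat) (K : algebra ar -> Prop).
Hypothesis qK : quasivariety K.
Implicit Types A B C D : algebra ar.

Lemma ultraproduct_in (I : Type) (C : I -> algebra ar) (U : (I -> Prop) -> Prop) :
  ultrafilter U -> (forall i, K (C i)) ->
  exists D (q : prod_alg C -> D),
    [/\ K D, is_hom q & forall x y, q x = q y <-> U (fun i => x i = y i)].
Proof.
move=> ultU KC; have [nU0 UT US UI _] := ultU.
have cong : congruence (B := prod_alg C) (fun x y => U (fun i => x i = y i)).
  split.
  - by move=> x; apply: US UT _.
  - by move=> x y xy; apply: US xy _ => i ->.
  - by move=> x y z xy yz; apply: US (UI _ _ xy yz) _ => i [-> ->].
  - move=> f a b /(ultrafilter_forall ultU) ab; apply: US ab _ => i ab /=.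
    by congr ops; apply: funext.
have [D [q [qh qs qk]]] := quotient_exists cong.
by exists D, q; split=> //; have [_ _ _ KU] := qK; exact: KU qk.
Qed.

(** * Kernels of homomorphisms into members of the quasivariety *)

(** These are the relative congruences of [B]. Leaving [h] free to miss part of [C] eases
    constructions; restricting to the image makes it surjective. *)
Definition ker_in B (theta : B -> B -> Prop) : Prop :=
  exists C (h : B -> C), [/\ K C, is_hom h & forall x y, h x = h y <-> theta x y].

Lemma ker_in_quotient B (theta : B -> B -> Prop) : ker_in theta ->
  exists C (h : B -> C),
    [/\ K C, is_hom h, surj h & forall x y, h x = h y <-> theta x y].
Proof.
case=> C [h [KC hh hk]].
have cl : subuniverse (fun c => exists b, True /\ h b = c).
  by apply: image_subuniverse.
have mem x : exists b, True /\ h b = h x by exists x.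
have ne : inhabited {c | exists b, True /\ h b = c}.
  by case: (alg_inh B) => x; exact: (inhabits (exist _ (h x) (mem x))).
exists (subalg cl ne), (fun x => exist _ (h x) (mem x)); split.
- by have [_ KS _ _] := qK; exact: KS.
- by move=> f args; apply: eq_exist; exact: hh.
- by move=> [c cP]; have [b [_ e]] := cP; exists b; exact: eq_exist.
- by move=> x y; rewrite -hk; split=> [[]//|?]; exact: eq_exist.
Qed.

Lemma ker_in_comp B C (e : B -> C) (psi : C -> C -> Prop) :
  is_hom e -> ConK K psi -> ker_in (fun x y => psi (e x) (e y)).
Proof.
move=> he [_ [D [h [KD hh _ hk]]]]; exists D, (fun x => h (e x)).
by split=> //; exact: is_hom_comp.
Qed.

Lemma ker_in_forall (I : Type) B (th : I -> B -> B -> Prop) :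
  (forall i, ker_in (th i)) -> ker_in (fun x y => forall i, th i x y).
Proof.
move=> kth; have [C CP] := @choice _ _ _ kth.
pose h i := projT1 (cid (CP i)).
have hP i : [/\ K (C i), is_hom (h i) & forall x y, h i x = h i y <-> th i x y].
  exact: (projT2 (cid (CP i))).
exists (prod_alg C), (fun b i => h i b); split.
- by have [_ _ KP _] := qK; apply: KP => i; have [] := hP i.
- by apply: is_hom_prod => i; have [] := hP i.
- move=> x y; split=> [e i|e].
    have [_ _ <-] := hP i; exact: (f_equal (fun g : prod_alg C => g i) e).
  by apply: functional_extensionality_dep => i; have [_ _ ->] := hP i.
Qed.

Lemma ker_in_forall_in (I : Type) (P : I -> Prop) B (th : I -> B -> B -> Prop) :
  (forall i, P i -> ker_in (th i)) ->
  ker_in (fun x y => forall i, P i -> th i x y).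
Proof.
move=> kth.
have := @ker_in_forall {i | P i} B (fun i => th (proj1_sig i)).
case=> [[i Pi]|C [h [KC hh hk]]]; first exact: kth.
exists C, h; split=> // x y; rewrite hk; split=> [e i Pi|e [i Pi] /=].
  exact: (e (exist _ i Pi)).
exact: e.
Qed.

(** The union is the kernel of a map into an ultraproduct whose ultrafilter contains every cone: a
    pair related at one index is related at all later ones, and sets in the ultrafilter are
    nonempty. *)
Lemma ker_in_directed (I : Type) (le : I -> I -> Prop) B
    (th : I -> B -> B -> Prop) :
  inhabited I -> (forall i, le i i) ->
  (forall i j k, le i j -> le j k -> le i k) ->
  (forall i j, exists k, le i k /\ le j k) ->
  (forall i j x y, le i j -> th i x y -> th j x y) ->
  (forall i, ker_in (th i)) -> ker_in (fun x y => exists i, th i x y).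
Proof.
move=> inh rfl trans dir mono kth; have [C CP] := @choice _ _ _ kth.
pose h i := projT1 (cid (CP i)).
have hP i : [/\ K (C i), is_hom (h i) & forall x y, h i x = h i y <-> th i x y].
  exact: (projT2 (cid (CP i))).
have [U [ultU Ule]] := directed_ultrafilter inh rfl trans dir.
have [nU0 UT US UI _] := ultU.
have [|D [q [KD qh qk]]] := ultraproduct_in ultU (C := C).
  by move=> i; have [] := hP i.
exists D, (fun x => q (fun i => h i x)); split=> //.
  apply: (is_hom_comp (B := prod_alg C) (h := fun x i => h i x) (g := q)) => //.
  by apply: is_hom_prod => i; have [] := hP i.
move=> x y; rewrite qk; split=> [Uxy|[i xy]].
  apply: contrapT => nxy; apply: nU0; apply: US Uxy _ => i.
  by have [_ _ ->] := hP i => xy; apply: nxy; exists i.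
by apply: US (Ule i) _ => j ij; have [_ _ ->] := hP j; exact: mono xy.
Qed.

(** The coding [p] lets Zorn's lemma treat one relation as a set of pairs and an indexed family as a
    set of triples. *)
Lemma ker_in_chain T (G : set (set T)) B (p : B -> B -> T) :
  (exists X, G X) -> total_on G subset ->
  (forall X, G X -> ker_in (fun x y => X (p x y))) ->
  ker_in (fun x y => (\bigcup_(X in G) X)%classic (p x y)).
Proof.
move=> [X0 GX0] tot kG.
have [| | | | | |C [h [KC hh hk]]] := @ker_in_directed {X | G X}
    (fun X Y => (proj1_sig X `<=` proj1_sig Y)%classic) B
    (fun X x y => proj1_sig X (p x y)).
- exact: (inhabits (exist _ X0 GX0)).
- by move=> X t.
- by move=> X Y Z XY YZ x /XY /YZ.
- move=> X Y; case: (tot _ _ (proj2_sig X) (proj2_sig Y)) => XY.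
    by exists Y; split=> // t.
  by exists X; split=> // t.
- by move=> X Y x y XY; exact: XY.
- by move=> [X GX]; exact: kG.
exists C, h; split=> // x y; rewrite hk; split=> [[[X GX] /= Xxy]|[X GX Xxy]].
  by exists X.
by exists (exist _ X GX).
Qed.

End Quasivariety.

(** [Zorn_bigcup] also asks about the empty chain, whose union is empty; passing to the sets [X0]
    union [X] turns that case into [P X0]. *)
Lemma Zorn_above T (P : set (set T)) (X0 : set T) : P X0 ->
  (forall G : set (set T), (exists X, G X) -> (G `<=` P)%classic ->
    total_on G subset -> P (\bigcup_(X in G) X)%classic) ->
  exists X, [/\ P X, (X0 `<=` X)%classic &
    forall Y, P Y -> (X `<=` Y)%classic -> (Y `<=` X)%classic].
Proof.
move=> PX0 PU.
have [G GP Gtot|X [PX Xmax]] := @Zorn_bigcup _ (fun X => P (X0 `|` X)%classic).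
  have [[X GX]|nG] := pselect (exists X, G X); last first.
    suff -> : (X0 `|` \bigcup_(X in G) X)%classic = X0 by [].
    apply/seteqP; split=> [t [//|[X GX]]|t X0t]; last by left.
    by case: nG; exists X.
  have -> : (X0 `|` \bigcup_(X in G) X)%classic =
      (\bigcup_(X in [set X0 `|` Y | Y in G]) X)%classic.
    apply/seteqP; split=> [t [X0t|[Y GY Yt]]|t [_ [Y GY <-] [X0t|Yt]]].
    - by exists (X0 `|` X)%classic; [exists X|left].
    - by exists (X0 `|` Y)%classic; [exists Y|right].
    - by left.
    - by right; exists Y.
  apply: PU; first by exists (X0 `|` X)%classic, X.
  - by move=> _ [Y GY <-]; exact: GP.
  - move=> _ _ [Y GY <-] [Z GZ <-].
    by case: (Gtot _ _ GY GZ) => YZ; [left|right]; exact: setUS.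
exists (X0 `|` X)%classic; split=> [//|t ?|]; first by left.
move=> Y PY XY; apply: contrapT => nYX; apply: (Xmax Y).
  split; last by move=> YX; apply: nYX => t /YX; right.
  by move=> t Xt; apply: XY; right.
suff -> : (X0 `|` Y)%classic = Y by [].
by apply/seteqP; split=> [t [X0t|//]|t]; [apply: XY; left|right].
Qed.

(** * Compactness of epimorphicity *)

Lemma In_index (T : Type) (s : seq T) x : List.In x s ->
  exists i : 'I_(size s), tnth (in_tuple s) i = x.
Proof.
move=> xs; have [i [/ltP lti <-]] := List.In_nth s x x xs.
exists (Ordinal lti); rewrite (tnth_nth x) /=.
by elim: s i {xs lti} => [|y s IH] [|i] //=.
Qed.

Lemma tnth_In (T : Type) (s : seq T) (i : 'I_(size s)) :
  List.In (tnth (in_tuple s) i) s.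
Proof.
rewrite (tnth_nth (tnth (in_tuple s) i)) /=.
move: (tnth _ i) (nat_of_ord i) (ltn_ord i) => {i} x0.
by elim: s => [|y s IH] [|j] //= ltj; [left|right; exact: IH].
Qed.

Lemma finite_list_choice (T : Type) (S : T -> Prop) k (P : 'I_k -> seq T -> Prop) :
  (forall i s t, List.incl s t -> P i s -> P i t) ->
  (forall i, exists s, (forall x, List.In x s -> S x) /\ P i s) ->
  exists s, (forall x, List.In x s -> S x) /\ forall i, P i s.
Proof.
elim: k P => [|k IH] P mono ex; first by exists [::]; split=> // -[].
have [s0 [s0S P0]] := ex ord0.
have [|i|s [sS Ps]] := IH (fun i => P (lift ord0 i)).
- by move=> i; exact: mono.
- exact: ex.
exists (s0 ++ s)%list; split.
  by move=> x /List.in_app_iff[/s0S|/sS].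
move=> i; case: (unliftP ord0 i) => [j ->|->].
  by apply: mono (Ps j); exact: List.incl_appr (List.incl_refl _).
by apply: mono P0; exact: List.incl_appl (List.incl_refl _).
Qed.

(** Operations have finite arity, so the elements generated by [b] and finitely many members of [T]
    form a subuniverse. *)
Lemma sg_finite (F : Type) (ar : F -> nat) (B : algebra ar) (T : B -> Prop) b x :
  sg (fun y => T y \/ y = b) x ->
  exists s, (forall y, List.In y s -> T y) /\
            sg (fun y => List.In y s \/ y = b) x.
Proof.
move/(_ (fun x => exists s, (forall y, List.In y s -> T y) /\
            sg (fun y => List.In y s \/ y = b) x)); apply; last first.
  move=> y [Ty|->].
    exists [:: y]; split; first by move=> z /= [<-|].
    by apply: sg_gen; left; left.
  by exists [::]; split=> //; apply: sg_gen; right.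
move=> f args /finite_list_choice[].
  move=> i s t st; apply: sg_le => y [/st ys|->]; apply: sg_gen; first by left.
  by right.
by move=> s [sT gs]; exists s; split=> //; exact: sg_subuniverse.
Qed.

(** Induction over [sg X] runs in [B], so the predicate carries along the membership proof that
    places an element in the subalgebra. *)
Lemma sg_in_subalg (F : Type) (ar : F -> nat) (B : algebra ar) (X : B -> Prop)
    (cl : subuniverse (sg X)) ne (Y : subalg cl ne -> Prop) :
  (forall x p, X x -> Y (exist _ x p)) -> forall d, sg Y d.
Proof.
move=> XY [x p]; suff [q] : exists q, sg Y (exist _ x q).
  by rewrite (Prop_irrelevance p q).
apply: (p (fun x => exists q, sg Y (exist _ x q))) => [f args args_in|y Xy].
  pose q i := let: ex_intro q _ := args_in i in q.
  have qP i : sg Y (exist _ (args i) (q i)) by rewrite /q; case: (args_in i).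
  exists (cl f args q).
  exact: (@sg_subuniverse _ _ (subalg cl ne) Y f
    (fun i => exist _ (args i) (q i)) qP).
by exists (sg_gen Xy); apply: sg_gen; exact: XY.
Qed.

Section Dominion.
Variables (F : Type) (ar : F -> nat) (K : algebra ar -> Prop).
Hypothesis qK : quasivariety K.

(** Isbell's dominion, pointwise: a subalgebra is epic when its dominion is the whole algebra. *)
Definition in_dominion (B : algebra ar) (X : B -> Prop) (b : B) : Prop :=
  forall C, K C -> forall g1 g2 : B -> C, is_hom g1 -> is_hom g2 ->
    (forall x, X x -> g1 x = g2 x) -> g1 b = g2 b.

(** Otherwise every finite list from [T] has two homomorphisms agreeing on it but not at [b]. An
    ultraproduct over the lists, ordered by inclusion, yields two that agree on all of [T] and still
    differ at [b]. *)
Lemma dominion_compact (B : algebra ar) (T : B -> Prop) b : in_dominion T b ->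
  exists s, (forall y, List.In y s -> T y) /\ in_dominion (fun y => List.In y s) b.
Proof.
move=> Tb; apply: contrapT => ns.
pose I := {s : seq B | forall y, List.In y s -> T y}.
have ex (i : I) : exists C : algebra ar, K C /\ exists g : (B -> C) * (B -> C),
    [/\ is_hom g.1, is_hom g.2, (forall x, List.In x (sval i) -> g.1 x = g.2 x) &
        g.1 b <> g.2 b].
  apply: contrapT => nC; apply: ns; exists (sval i); split; first exact: (proj2_sig i).
  move=> C KC g1 g2 h1 h2 e; apply: contrapT => ne.
  by apply: nC; exists C; split=> //; exists (g1, g2).
have [C CP] := @choice _ _ _ ex.
pose g i := projT1 (cid (proj2 (CP i))).
have gP i := projT2 (cid (proj2 (CP i))).
have [||i j k ij jk|i j|U [ultU Ule]] := @directed_ultrafilter I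
    (fun i j => List.incl (sval i) (sval j)).
- by apply: (inhabits (exist _ [::] _)).
- by move=> i; exact: List.incl_refl.
- exact: List.incl_tran ij jk.
- have ijT y : List.In y (sval i ++ sval j)%list -> T y.
    by move=> /List.in_app_iff[]; [exact: (proj2_sig i)|exact: (proj2_sig j)].
  exists (exist _ (sval i ++ sval j)%list ijT).
  split; first exact: List.incl_appl (List.incl_refl _).
  exact: List.incl_appr (List.incl_refl _).
have [nU0 UT US UI _] := ultU.
have [|D [q [KD qh qk]]] := ultraproduct_in qK ultU (C := C).
  by move=> i; have [] := CP i.
have hom1 : is_hom (fun x => q (fun i => (g i).1 x)).
  apply: (is_hom_comp (B := prod_alg C) (h := fun x i => (g i).1 x) (g := q)) => //.
  by apply: is_hom_prod => i; have [] := gP i.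
have hom2 : is_hom (fun x => q (fun i => (g i).2 x)).
  apply: (is_hom_comp (B := prod_alg C) (h := fun x i => (g i).2 x) (g := q)) => //.
  by apply: is_hom_prod => i; have [] := gP i.
have agree x : T x -> q (fun i => (g i).1 x) = q (fun i => (g i).2 x).
  move=> Tx; apply/qk.
  (* The cone above the one-element list of [x] lies in [U], and every list in it contains [x]. *)
  have xT y : List.In y [:: x] -> T y by move=> /= [<-|].
  apply: US (Ule (exist _ [:: x] xT)) _ => i xi.
  by have [_ _ + _] := gP i; apply; apply: xi; left.
have /qk Ub := Tb D KD _ _ hom1 hom2 agree.
by apply: nU0; apply: US Ub _ => i; have [] := gP i.
Qed.

Lemma weak_ES_no_fully_epic (D : algebra ar) (T : D -> Prop) :
  weak_ES K -> K D -> fingen D -> ~ fully_epic K T.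
Proof.
move=> wES KD [k [g gP]] [cl [ne [[[d nTd] [b bP] _] [_ epi]]]].
have Tb : in_dominion T b.
  move=> C KC g1 g2 h1 h2 e; apply: epi => // -[x Tx]; exact: e.
have [s1 [s1T s1b]] := dominion_compact Tb.
have [i|i|s2 [s2T s2g]] := @finite_list_choice D T k
    (fun i s => sg (fun y => List.In y s \/ y = b) (g i)).
- move=> s t st; apply: sg_le => y [/st ys|->]; apply: sg_gen; first by left.
  by right.
- exact: sg_finite.
case: (ne) => -[t Tt].
(* [t] makes the generated subalgebra nonempty, [s1] forces agreement at [b], and [s2] together with
   [b] generates every [g i]. *)
pose s := (t :: s1 ++ s2)%list.
have sT y : List.In y s -> T y by move=> /= [<-//|/List.in_app_iff[/s1T|/s2T]].
pose S := sg (fun y => List.In y s).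
have clS : subuniverse S by exact: sg_subuniverse.
have St : S t by apply: sg_gen; left.
have mem y : List.In y s -> S y by exact: sg_gen.
pose D' := subalg clS (inhabits (exist _ t St)).
have KD' : K D' by have [_ KS _ _] := qK; exact: KS.
have fgD' : fingen D'.
  exists (size s), (fun i => exist _ (tnth (in_tuple s) i) (mem _ (tnth_In i))).
  apply: (@sg_in_subalg _ _ D _ clS) => x p xs.
  by have [i ix] := In_index xs; exists i; exact: eq_exist.
have epiS : K_epi K (fun x : D' => proj1_sig x).
  split=> // C KC g1 g2 h1 h2 e.
  have eS x : S x -> g1 x = g2 x by move=> Sx; exact: (e (exist _ x Sx)).
  have eb : g1 b = g2 b.
    apply: s1b => // y ys1; apply: eS; apply: mem; right.
    by apply/List.in_app_iff; left.
  have eq_cl := equalizer_subuniverse h1 h2.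
  move=> x; apply: (gP x (fun x => g1 x = g2 x)) => // _ [i <-].
  apply: (s2g i (fun x => g1 x = g2 x)) => // y [ys2|->//].
  by apply: eS; apply: mem; right; apply/List.in_app_iff; right.
have fgD : fingen D by exists k, g.
have [[x Sx] /= xd] := wES D' D KD' KD fgD' fgD _ epiS d.
by apply: nTd; rewrite -xd; apply: Sx.
Qed.

End Dominion.

(** * Irredundant decompositions of a maximal separating congruence *)

(** This keeps the condition that a finite meet lies below [theta] stable under unions of chains of
    families. *)
Lemma chain_finite T (G : set (set T)) k (p : 'I_k -> T) :
  (exists X, G X) -> total_on G subset ->
  (forall i, (\bigcup_(X in G) X)%classic (p i)) ->
  exists X, G X /\ forall i, X (p i).
Proof.
move=> [X0 GX0] tot; elim: k p => [|k IH] p Gp; first by exists X0; split=> // -[].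
have [X [GX Xp]] := IH (fun i => p (lift ord0 i)) (fun i => Gp _).
have [Y GY Yp] := Gp ord0.
case: (tot _ _ GX GY) => XY; [exists Y|exists X]; split=> // i;
  by case: (unliftP ord0 i) => [j ->|->] //; exact: XY.
Qed.

Section Separation.
Variables (F : Type) (ar : F -> nat) (K : algebra ar -> Prop).
Hypothesis qK : quasivariety K.
Variables (B : algebra ar) (A : B -> Prop) (b : B).
Hypotheses (KB : K B) (nAb : ~ A b).

(** Maximality is the source of fullness: when the subuniverse [A] and [b] generate [B], a strictly
    larger relative congruence relates [b], hence every element, to [A]. *)
Definition max_separating (theta : B -> B -> Prop) :=
  [/\ ker_in K theta, ~ (exists a, A a /\ theta b a) &
      forall psi, ker_in K psi -> (forall x y, theta x y -> psi x y) ->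
        (forall x y, psi x y -> theta x y) \/ exists a, A a /\ psi b a].

Lemma max_separating_exists : exists theta, max_separating theta.
Proof.
pose P (X : set (B * B)) := ker_in K (fun x y => X (x, y)) /\
  ~ exists a, A a /\ X (b, a).
have [||X [[kX nX] _ Xmax]] := @Zorn_above _ P [set p | p.1 = p.2]%classic.
- split; first by exists B, id.
  by move=> [a [Aa /= e]]; apply: nAb; rewrite e.
- move=> G neG GP tot; split.
    by apply: (ker_in_chain qK (p := fun x y => (x, y))) => // X /GP[].
  by move=> [a [Aa [X /GP[_ nX] Xa]]]; apply: nX; exists a.
exists (fun x y => X (x, y)); split=> // psi kpsi Xpsi.
have [|npsi] := pselect (exists a, A a /\ psi b a); [by right|left=> x y xy].
apply: (Xmax (fun p => psi p.1 p.2)) => // -[u v]; exact: Xpsi.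
Qed.

Variable theta : B -> B -> Prop.

Definition irredundant k (Th : 'I_k -> B -> B -> Prop) :=
  [/\ forall i, ker_in K (Th i), forall i x y, theta x y -> Th i x y,
      forall x y, (forall i, Th i x y) -> theta x y &
      forall i, ~ forall x y, (forall j, j != i -> Th j x y) -> theta x y].

(* If every proper submeet of [Th] were larger than [theta], it would identify
   [b] with some [a_i] in [A], and the near unanimity term would give
   [phi (a_1, ..., a_n) = b] modulo [theta]. *)
Lemma irredundant_nu n (phi : term ar 'I_n) (Th : 'I_n -> B -> B -> Prop) :
  subuniverse A -> max_separating theta -> nu_term K phi -> ~ irredundant Th.
Proof.
move=> clA [_ nth thmax] nu [kTh thTh Thth irr].
have ex i : exists a, A a /\ forall j, j != i -> Th j b a.
  have [| |sub|//] := thmax (fun x y => forall j, j != i -> Th j x y).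
  - by apply: ker_in_forall_in.
  - by move=> x y xy j _; exact: thTh.
  - by case: (irr i).
have [a aP] := @choice _ _ _ ex.
apply: nth; exists (eval a phi); split.
  by apply: eval_subuniverse => // i; have [] := aP i.
apply: Thth => i; have [C [h [KC hh hk]]] := kTh i.
(* Modulo [Th i], every [a j] with [j != i] equals [b], so [phi] sees [b] everywhere except in place
   [i]. *)
apply/hk; rewrite eval_hom // -[LHS](nu C KC (h b) (h (a i)) i).
congr eval; apply: funext => j; case: eqP => [->//|/eqP ji].
by apply/hk; have [_] := aP j; apply; rewrite eq_sym.
Qed.

Definition maximal_decomposition k (Th : 'I_k -> B -> B -> Prop) :=
  forall i ga, ker_in K ga -> (forall x y, Th i x y -> ga x y) ->
    (forall x y, ga x y -> (forall j, j != i -> Th j x y) -> theta x y) ->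
    forall x y, ga x y -> Th i x y.

(** Zorn's lemma acts on the whole family, coded as a set of triples. Irredundance survives
    enlargement: a submeet of the larger family inside [theta] would contain the same submeet of
    [Th0]. *)
Lemma irredundant_maximal k (Th0 : 'I_k -> B -> B -> Prop) : irredundant Th0 ->
  exists Th : 'I_k -> B -> B -> Prop, irredundant Th /\ maximal_decomposition Th.
Proof.
move=> [kTh0 thTh0 Th0th irr0].
pose P (X : set ('I_k * B * B)) := (forall i, ker_in K (fun x y => X (i, x, y))) /\
  forall x y, (forall i, X (i, x, y)) -> theta x y.
have [||X [[kX Xth] X0X Xmax]] := @Zorn_above _ P (fun p => Th0 p.1.1 p.1.2 p.2).
- by [].
- move=> G neG GP tot; split.
    move=> i; apply: (ker_in_chain qK (p := fun x y => (i, x, y))) => // X /GP[+ _].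
    exact.
  by move=> x y /(chain_finite neG tot)[X [/GP[_ +] Xxy]]; exact.
exists (fun i x y => X (i, x, y)); split.
  split=> //; first by move=> i x y /(thTh0 i) Thxy; exact: X0X.
  move=> i sub; apply: (irr0 i) => x y Thxy; apply: sub => j ji.
  by apply: X0X; exact: Thxy.
move=> i ga kga Xga meet x y xy.
apply: (Xmax (fun p => if p.1.1 == i then ga p.1.2 p.2 else X p)).
- split=> [j|u v uv].
    by case: (eqVneq j i).
  apply: meet; first by have := uv i; rewrite /= eqxx.
  by move=> j /negbTE ji; have := uv j; rewrite /= ji.
- by move=> [[j u] v] /=; case: (eqVneq j i) => [->|//]; exact: Xga.
- by rewrite /= eqxx.
Qed.

(** The total relation qualifies too; nontriviality is assumed separately below. *)
Definition meet_irreducible (al : B -> B -> Prop) :=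
  forall be ga, ker_in K be -> ker_in K ga -> (forall x y, al x y -> be x y) ->
    (forall x y, al x y -> ga x y) -> (forall x y, be x y -> ga x y -> al x y) ->
    (forall x y, be x y -> al x y) \/ (forall x y, ga x y -> al x y).

(* Splitting a component [Th i] as [be /\ ga] would produce a longer
   irredundant decomposition. *)
Lemma maximal_meet_irreducible k (Th : 'I_k -> B -> B -> Prop) i :
  irredundant Th -> maximal_decomposition Th ->
  ~ (exists Th' : 'I_k.+1 -> B -> B -> Prop, irredundant Th') ->
  meet_irreducible (Th i).
Proof.
move=> [kTh thTh Thth irr] maxTh nex be ga kbe kga albe alga bega.
apply: contrapT => /not_orP[nbe nga]; apply: nex.
exists (fun l => if unlift ord0 l is Some j then
                   (if j == i then ga else Th j) else be).
have lift0 (j : 'I_k) : lift ord0 j != ord0 by rewrite eq_sym neq_lift.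
split.
- by move=> l; case: unliftP => [j _|_] //; case: eqP.
- move=> l x y xy; case: unliftP => [j _|_]; last exact/albe/thTh.
  by case: eqP => [_|_]; [exact/alga/thTh|exact: thTh].
- move=> x y xy; apply: Thth => j.
  have [->|ji] := eqVneq j i.
    apply: bega; first by have := xy ord0; rewrite unlift_none.
    by have := xy (lift ord0 i); rewrite liftK eqxx.
  by have := xy (lift ord0 j); rewrite liftK (negbTE ji).
(* If [ga] or [be] could be dropped, maximality would put the other one below [Th i]. If another
   component could be dropped, it could be dropped from [Th] as well, since [Th i] lies below both
   [be] and [ga]. *)
- move=> l; case: (unliftP ord0 l) => [j ->|->] sub.
    have [ji|ji] := eqVneq j i.
      apply: nbe; apply: maxTh => // x y bexy Thxy.
      apply: sub => l'; case: unliftP => [j' -> |//].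
      by rewrite (inj_eq lift_inj) ji => j'i; rewrite (negbTE j'i); exact: Thxy.
    apply: (irr j) => x y Thxy; apply: sub => l'.
    have Thi : Th i x y by apply: Thxy; rewrite eq_sym.
    case: unliftP => [j' ->|_ _]; last exact: albe.
    rewrite (inj_eq lift_inj) => j'j; case: eqP => _; [exact: alga|exact: Thxy].
  apply: nga; apply: maxTh => // x y gaxy Thxy.
  apply: sub => l'; case: unliftP => [j' _ _ |->]; last by rewrite eqxx.
  by case: eqP => [//|/eqP ?]; exact: Thxy.
Qed.

(** Induction from binary to finite meets; the empty meet is total, which [al] is not. *)
Lemma meet_irreducible_finite (al : B -> B -> Prop) (J : eqType)
    (psi : J -> B -> B -> Prop) (s : seq J) :
  meet_irreducible al -> (exists x y, ~ al x y) ->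
  (forall j, ker_in K (psi j)) -> (forall j x y, al x y -> psi j x y) ->
  (forall x y, (forall j, j \in s -> psi j x y) -> al x y) ->
  exists j, forall x y, psi j x y -> al x y.
Proof.
move=> irr [u [v nal]] kpsi alpsi; elim: s => [|j s IH] meet.
  by case: nal; exact: meet.
have [|||||be|ga] := irr (psi j) (fun x y => forall j, j \in s -> psi j x y).
- exact: kpsi.
- by apply: ker_in_forall_in.
- exact: alpsi.
- by move=> x y xy j' _; exact: alpsi.
- by move=> x y xy sxy; apply: meet => j'; rewrite inE => /orP[/eqP->//|]; exact: sxy.
- by exists j.
- exact: IH ga.
Qed.

(** A finite subdirect embedding of [C] presents [al] as the meet of the kernels of its coordinates
    pulled back to [B]; one of these kernels is [al], so that coordinate is injective. *)
Lemma meet_irreducible_RFSI (al : B -> B -> Prop) (C : algebra ar) (e : B -> C) :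
  meet_irreducible al -> (exists x y, ~ al x y) ->
  K C -> is_hom e -> surj e -> (forall x y, e x = e y <-> al x y) -> RFSI K C.
Proof.
move=> irr nt KC he se ek; split=> //.
  by have [x [y nal]] := nt; exists (e x), (e y); rewrite ek.
move=> m D KD f hf inj_f sub.
have hfi i : is_hom (fun c => f c i).
  by move=> g args; rewrite hf.
have [| | |i iP] := @meet_irreducible_finite al _
    (fun i x y => f (e x) i = f (e y) i) (enum 'I_m) irr nt.
- move=> i; exists (D i), (fun x => f (e x) i); split=> //.
  exact: (is_hom_comp he (hfi i)).
- by move=> i x y /ek ->.
- move=> x y xy; apply/ek/inj_f; apply: functional_extensionality_dep => i.
  by apply: xy; rewrite mem_enum.
exists i; split=> //; split; last exact: sub.
by move=> c d; have [x <-] := se c; have [y <-] := se d; move/iP/ek.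
Qed.

End Separation.

(** * Construction of a fully epic subalgebra *)

(** Serves to adjoin generators one at a time, and to find a decomposition length that cannot be
    raised by one. *)
Lemma nat_first_step (P : nat -> Prop) k : ~ P 0 -> P k ->
  exists j, [/\ j < k, ~ P j & P j.+1].
Proof.
move=> nP0; elim: k => [//|k IH] Pk.
have [/IH[j [ltjk nPj Pj]]|nPk] := pselect (P k); last by exists k.
by exists j; split=> //; exact: ltnW.
Qed.

Section Construction.
Variables (F : Type) (ar : F -> nat) (K : algebra ar -> Prop).
Hypothesis qK : quasivariety K.

Lemma almost_total_extension (B : algebra ar) (A0 : B -> Prop) d :
  fingen B -> subuniverse A0 -> ~ A0 d ->
  exists (A : B -> Prop) b,
    [/\ subuniverse A, forall x, A0 x -> A x, ~ A b &
        forall x, sg (fun y => A y \/ y = b) x].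
Proof.
move=> [k [g gP]] cl0 nd.
pose X j x := A0 x \/ exists i : 'I_k, i < j /\ g i = x.
have [||j [ltjk nj jP]] := @nat_first_step (fun j => forall x, sg (X j) x) k.
- by move=> /(_ d)/(_ A0 cl0) h; apply: nd; apply: h => x [//|[i []]].
- move=> x; apply: sg_le (gP x) => _ [i <-]; apply: sg_gen; right.
  by exists i.
pose b := g (Ordinal ltjk).
have sub x : X j.+1 x -> sg (X j) x \/ x = b.
  move=> [A0x|[i [+ <-]]]; first by left; apply: sg_gen; left.
  rewrite ltnS leq_eqVlt => /orP[/eqP ij|ij].
    by right; congr g; exact: val_inj.
  by left; apply: sg_gen; right; exists i.
exists (sg (X j)), b; split.
- exact: sg_subuniverse.
- by move=> x A0x; apply: sg_gen; left.
- move=> Ab; apply: nj => x; apply: sg_le (jP x) => y /sub[//|->//].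
- by move=> x; apply: sg_le (jP x) => y /sub; exact: sg_gen.
Qed.

Lemma fully_epic_image (B D : algebra ar) (A : B -> Prop) b theta (e : B -> D) :
  subuniverse A -> (exists a, A a) -> (forall x, sg (fun y => A y \/ y = b) x) ->
  (forall x, in_dominion K A x) -> max_separating K A b theta ->
  is_hom e -> surj e -> (forall x y, e x = e y <-> theta x y) ->
  fully_epic K (fun d => exists a, A a /\ e a = d).
Proof.
move=> clA [a0 Aa0] genb epA [_ nth thmax] he se ek.
have cl := image_subuniverse he clA.
have mem a : A a -> exists a', A a' /\ e a' = e a by move=> Aa; exists a.
exists cl, (inhabits (exist _ (e a0) (mem a0 Aa0))); split.
  split.
  - exists (e b) => -[a [Aa /esym/ek ba]]; by apply: nth; exists a.
  - exists (e b) => d; have [x <-] := se d; apply: sg_image (genb x) => //.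
    by move=> y [/mem|->]; [left|right].
  - move=> psi cpsi nid d; have [[rfl sym trans comp] _] := cpsi.
    (* Pulled back to [B], [psi] lies strictly above [theta], so it relates [b] to [A]; the elements
       it relates to [A] form a subuniverse containing [A] and [b]. *)
    have kpsi := ker_in_comp he cpsi.
    have [x y /ek->//|psith|[a [Aa ba]]] := thmax _ kpsi.
      case: nid => u v; split=> [|->//].
      have [x <-] := se u; have [y <-] := se v; by move/psith/ek.
    have [x <-] := se d.
    suff [a' [Aa' xa']] : exists a, A a /\ psi (e x) (e a).
      by exists (e a'); split=> //; exact: mem.
    apply: (genb x (fun x => exists a, A a /\ psi (e x) (e a))); last first.
      by move=> y [Ay|->]; [exists y|exists a].
    move=> f args /choice[as_ asP]; exists (ops as_); split.
      by apply: clA => i; have [] := asP i.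
    by rewrite !he; apply: comp => i; have [] := asP i.
split=> // C KC g1 g2 h1 h2 agree d; have [x <-] := se d.
apply: (epA x C KC (fun x => g1 (e x)) (fun x => g2 (e x))).
- exact: is_hom_comp.
- exact: is_hom_comp.
- by move=> a Aa; exact: (agree (exist _ (e a) (mem a Aa))).
Qed.

Lemma exists_fully_epic n (phi : term ar 'I_n) (B : algebra ar) (A : B -> Prop) b :
  0 < n -> nu_term K phi -> K B -> fingen B ->
  subuniverse A -> (exists a, A a) -> ~ A b ->
  (forall x, sg (fun y => A y \/ y = b) x) -> (forall x, in_dominion K A x) ->
  exists (As : 'I_n.-1 -> algebra ar) (S : prod_alg As -> Prop)
         (cl : subuniverse S) (ne : inhabited {x : prod_alg As | S x}),
    [/\ (forall i, RFSI K (As i)),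
        (forall i (a : As i), exists x, S x /\ x i = a),
        fingen (subalg cl ne),
        K (subalg cl ne) &
        exists T : subalg cl ne -> Prop, fully_epic K T].
Proof.
move=> n0 nu KB [k [g gP]] clA [a0 Aa0] nAb genb epA.
have [theta thP] := max_separating_exists qK KB nAb.
have [kth nth _] := thP.
(* The shift by one starts at length one: the step found has a decomposition of length [j.+1], at
   most [n.-1], and none of length [j.+2]. *)
pose P j := ~ exists Th : 'I_j.+1 -> B -> B -> Prop, irredundant K theta Th.
have [||j [ltjn nPj Pj]] := @nat_first_step P n.-1.
(* [theta] alone is irredundant: the empty meet is total, and a total [theta] would relate [b] to
   [a0]. *)
- apply; exists (fun _ => theta); split=> // [x y|i tot]; first by apply; exact: ord0.
  apply: nth; exists a0; split=> //; apply: tot => j.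
  by rewrite [j]ord1 [i]ord1.
- rewrite /P prednK // => -[Th]; exact: (irredundant_nu qK clA thP nu).
have [Th0 /(irredundant_maximal qK)[Th [irrTh maxTh]]] := contrapT nPj.
have [kTh thTh Thth irr] := irrTh.
have nontriv i : exists x y, ~ Th i x y.
  apply: contrapT => triv; apply: (irr i) => x y xy; apply: Thth => l.
  have [->|/xy//] := eqVneq l i.
  by apply: contrapT => nxy; apply: triv; exists x, y.
have quot i := ker_in_quotient qK (kTh i).
have [C CP] := @choice _ _ _ quot.
pose e i := projT1 (cid (CP i)).
have eP i : [/\ K (C i), is_hom (e i), surj (e i) &
                forall x y, e i x = e i y <-> Th i x y].
  exact: (projT2 (cid (CP i))).
(* [inord] defaults to index 0 beyond [j], so the first factor is repeated until there are [n.-1] of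
   them. *)
pose As (i : 'I_n.-1) := C (inord i : 'I_j.+1).
pose E : B -> prod_alg As := fun x i => e (inord i) x.
have hE : is_hom E by apply: is_hom_prod => i; have [] := eP (inord i).
have kE x y : E x = E y <-> theta x y.
  split=> [Exy|xy]; last first.
    apply: functional_extensionality_dep => i.
    by have [_ _ _ ->] := eP (inord i); exact: thTh.
  apply: Thth => i; rewrite -[i]inord_val; have [_ _ _ <-] := eP (inord i).
  exact: (f_equal (fun p : prod_alg As => p (widen_ord ltjn i)) Exy).
have cl : subuniverse (fun p => exists x, True /\ E x = p).
  exact: image_subuniverse.
have mem x : exists x', True /\ E x' = E x by exists x.
have ne : inhabited {p | exists x, True /\ E x = p} := inhabits (exist _ (E b) (mem b)).
pose q x : subalg cl ne := exist _ (E x) (mem x).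
have hq : is_hom q by move=> f args; apply: eq_exist; exact: hE.
have sq : surj q.
  by move=> [p pP]; have [x [_ xp]] := pP; exists x; exact: eq_exist.
have kq x y : q x = q y <-> theta x y.
  by rewrite -kE; split=> [[]//|xy]; exact: eq_exist.
exists As, (fun p => exists x, True /\ E x = p), cl, ne; split.
- move=> i; have [KC he se ek] := eP (inord i).
  apply: meet_irreducible_RFSI (ek) => //.
  exact: maximal_meet_irreducible irrTh maxTh Pj.
- move=> i a; have [_ _ se _] := eP (inord i); have [x xa] := se a.
  by exists (E x).
- exists k, (fun i => q (g i)) => d; have [x <-] := sq d.
  by apply: sg_image (gP x) => // _ [i <-]; exists i.
- have [_ KS KP _] := qK; apply: (KS); apply: KP => i.
  by have [] := eP (inord i).
- exists (fun d => exists a, A a /\ q a = d).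
  by apply: fully_epic_image kq => //; exists a0.
Qed.

End Construction.

(** * The characterisation of the weak ES property *)

Theorem mainTheorem8 (F : Type) (ar : F -> nat) (K : algebra ar -> Prop)
    (n : nat) (phi : term ar 'I_n) :
  quasivariety K -> 3 <= n -> nu_term K phi ->
  (weak_ES K <->
   ~ exists (As : 'I_n.-1 -> algebra ar) (S : prod_alg As -> Prop)
            (cl : subuniverse S) (ne : inhabited {x : prod_alg As | S x}),
       [/\ (forall i, RFSI K (As i)),
           (forall i (a : As i), exists x, S x /\ x i = a),
           fingen (subalg cl ne),
           K (subalg cl ne) &
           exists T : subalg cl ne -> Prop, fully_epic K T]).
Proof.
move=> qK n3 nu; split.
  move=> wES [As [S [cl [ne [_ _ fgD KD [T]]]]]].
  exact: weak_ES_no_fully_epic.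
move=> nex A B KA KB fgA fgB h [hh epi] d; apply: contrapT => nd.
have cl0 : subuniverse (fun y => exists x, True /\ h x = y).
  exact: image_subuniverse.
(* The image of [h] is enlarged to an almost total [A'], which stays epic because maps agreeing on
   [A'] agree on the image. *)
have [|A' [b [clA' subA' nA'b genb]]] := almost_total_extension (d := d) fgB cl0.
  by move=> [x [_ xd]]; apply: nd; exists x.
have hA' x : A' (h x) by apply: subA'; exists x.
apply: nex; apply: (@exists_fully_epic _ _ _ qK _ phi B A' b) => //.
- exact: leq_trans n3.
- by case: (alg_inh A) => x; exists (h x).
- move=> x C KC g1 g2 h1 h2 agree; apply: epi => // a; exact: agree.
Qed.
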